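(* Let $\mathcal V$ be a Euclidean Jordan algebra, and let $\Theta:\mathcal V\to\overline{\mathbb R}:=[-\infty,+\infty]$ be a function. Let $F:\mathcal V\to\mathbb{R}$ be a weakly spectral function, and let $\mathcal E\subseteq \mathcal V$ be a weakly spectral set. Let $a\in\mathcal V$ be such that $\Theta$ is (subdifferentially) regular at $a$. Suppose that $a$ is a local minimizer of the map $$x\in \mathcal E \mapsto \Theta(x)+F(x)$$ (i.e. $a\in\mathcal E$ and $\Theta(a)+F(a)\le\Theta(x)+F(x)$ for all $x\in\mathcal E$ in some neighborhood of $a$), and suppose that the following condition is satisfied: if $a$ operator commutes with $v\in\partial^\infty\Theta(a)$, then $v=0$. Then $a$ operator commutes with some element of the limiting subdifferential $\partial\Theta(a)$.
   Context: A Euclidean Jordan algebra is a finite dimensional real inner product space $(\mathcal V,\langle\cdot,\cdot\rangle)$ with a bilinear product $\circ:\mathcal V\times\mathcal V\to\mathcal V$ that is commutative, satisfies the Jordan identity $x^2\circ(x\circ y)=x\circ(x^2\circ y)$ (with $x^2=x\circ x$), satisfies $\langle x\circ y,z\rangle=\langle y,x\circ z\rangle$ for all $x,y,z$, and (standing assumption) has a unit element $e$. The norm $\|\cdot\|$ is the one induced by the inner product. For $a\in\mathcal V$, $L_a:\mathcal V\to\mathcal V$ is $L_ax=a\circ x$. Elements $a,b\in\mathcal V$ operator commute if $L_aL_b=L_bL_a$. $\operatorname{Aut}(\mathcal V)$ is the set of invertible linear maps $X:\mathcal V\to\mathcal V$ with $X(a\circ b)=Xa\circ Xb$ for all $a,b\in\mathcal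 V$. A set $\mathcal E\subseteq\mathcal V$ is weakly spectral if $x\in\mathcal E$ implies $Xx\in\mathcal E$ for all $X\in\operatorname{Aut}(\mathcal V)$. A function $F:\mathcal V\to\mathbb R$ is weakly spectral if $F(Xx)=F(x)$ for all $x\in\mathcal V$, $X\in\operatorname{Aut}(\mathcal V)$. Let $f:\mathcal V\to\overline{\mathbb R}$ and let $f(\bar x)$ be finite. The Fréchet subdifferential is $$\widehat\partial f(\bar x):=\Big\{v\in\mathcal V:\liminf_{x\to\bar x}\frac{f(x)-f(\bar x)-\langle v,x-\bar x\rangle}{\|x-\bar x\|}\ge0\Big\}.$$ The limiting (Mordukhovich) subdifferential $\partial f(\bar x)$ is the set of $v\in\mathcal V$ for which there are sequences $x^k\to\bar x$ with $f(x^k)\to f(\bar x)$ and $v^k\in\widehat\partial f(x^k)$ with $v^k\to v$. The horizon subdifferential $\partial^\infty f(\bar x)$ is the set of $v\in\mathcal V$ for which there are sequences $x^k\to\bar x$ with $f(x^k)\to f(\bar x)$, $v^k\in\widehat\partial f(x^k)$, and positive reals $t_k\downarrow0$ with $t_kv^k\to v$. The horizon cone $C^\infty$ of a nonempty set $C\subseteq\mathcal V$ is the set of $x\in\mathcal V$ for which there are sequences $x^k\in C$ and positive reals $t_k\downarrow0$ with $t_kx^k\to x$. $f$ is (subdifferentially) regular at $\bar x$ if $f(\bar x)$ is finite, $f$ is lower semicontinuous around $\bar x$, $\partial f(\bar x)=\widehat\partial f(\bar x)\ne\emptyset$, and $\partial^\infty f(\bar x)=(\widehat\partial f(\bar x))^\infty$.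 *)

(* Defs.v *)
From HB Require Import structures.
From mathcomp Require Import all_boot all_order all_algebra.
From mathcomp Require Import all_classical all_reals all_analysis.

Set Implicit Arguments.
Unset Strict Implicit.
Unset Printing Implicit Defensive.

Import Order.TTheory GRing.Theory Num.Theory.
Import numFieldNormedType.Exports.

Local Open Scope classical_set_scope.
Local Open Scope ring_scope.

(* The topology of V is that of its [normedModType] structure; [normr_dot]
   forces it to be the one induced by the inner product. *)
HB.mixin Record isEuclideanJordan (R : realType) (V : Type)
    & NormedModule R V & Vector R V := {
  dot : {dot V for idfun};
  jmul : {bilinear V -> V -> V};
  jone : V;
  normr_dot : forall x : V, `|x| = Num.sqrt (dot x x);
  jmulC : forall x y : V, jmul x y = jmul y x;
  jordan_identity : forall x y : V,
    jmul (jmul x x) (jmul x y) = jmul x (jmul (jmul x x) y);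
  dot_jmul : forall x y z : V, dot (jmul x y) z = dot y (jmul x z);
  jmul1 : forall x : V, jmul jone x = x
}.

#[short(type="euclideanJordanType")]
HB.structure Definition EuclideanJordan (R : realType) :=
  {V of NormedModule R V & Vector R V & isEuclideanJordan R V}.

Section JordanAlgebra.
Variables (R : realType) (V : euclideanJordanType R).
Implicit Types (a b x y v : V) (X : 'End(V)) (E : set V) (F : V -> R).

Definition Lop a : V -> V := fun x => jmul a x.

Definition operator_commute a b := Lop a \o Lop b = Lop b \o Lop a.

Definition jordan_aut : set 'End(V) :=
  [set X | bijective X /\ forall a b, X (jmul a b) = jmul (X a) (X b)].

Definition weakly_spectral_set E :=
  forall X, jordan_aut X -> forall x, E x -> E (X x).

Definition weakly_spectral_fun F :=
  forall X, jordan_aut X -> forall x, F (X x) = F x.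

Section Subdifferentials.
Variable f : V -> \bar R.
Local Open Scope ereal_scope.

(* The lower limit is taken over x <> xbar, and the set is empty where f is
   not finite. *)
Definition frechet_subdiff (xbar : V) : set V :=
  [set v | f xbar \is a fin_num /\
     0 <= limf_einf
            (fun x : V => (f x - f xbar - (dot v (x - xbar)%R)%:E)
                          / (`|x - xbar|%R)%:E)
            xbar^'].

Definition limiting_subdiff (xbar : V) : set V :=
  [set v | f xbar \is a fin_num /\ exists x_ v_ : nat -> V,
     [/\ x_ @ \oo --> xbar, f \o x_ @ \oo --> f xbar,
         forall k, frechet_subdiff (x_ k) (v_ k) & v_ @ \oo --> v]].

(* Here and below, t_k decreasing to 0 is in the sense of variational analysis:
   t_k > 0 and t_k --> 0, not necessarily monotonically. *)
Definition horizon_subdiff (xbar : V) : set V :=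
  [set v | f xbar \is a fin_num /\
     exists (x_ v_ : nat -> V) (t_ : nat -> R),
     [/\ x_ @ \oo --> xbar, f \o x_ @ \oo --> f xbar,
         forall k, frechet_subdiff (x_ k) (v_ k),
         (forall k, (0 < t_ k)%R) /\ t_ @ \oo --> (0 : R)%R &
         (fun k => t_ k *: v_ k)%R @ \oo --> v]].

(* Pointwise version of [lower_semicontinuous]. *)
Definition lower_semicontinuous_at (x : V) :=
  forall r : R, r%:E < f x -> \forall y \near x, r%:E < f y.

End Subdifferentials.

Definition horizon_cone (C : set V) : set V :=
  [set x | exists (x_ : nat -> V) (t_ : nat -> R),
     [/\ forall k, C (x_ k),
         forall k, 0 < t_ k, t_ @ \oo --> (0 : R) &
         (fun k => t_ k *: x_ k) @ \oo --> x]].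

Definition subdiff_regular (f : V -> \bar R) (xbar : V) :=
  [/\ f xbar \is a fin_num,
      \forall x \near xbar, lower_semicontinuous_at f x,
      limiting_subdiff f xbar = frechet_subdiff f xbar,
      frechet_subdiff f xbar !=set0 &
      horizon_subdiff f xbar = horizon_cone (frechet_subdiff f xbar)].

Definition local_minimizer (E : set V) (g : V -> \bar R) a :=
  E a /\ \forall x \near a, E x -> (g a <= g x)%E.

End JordanAlgebra.

(* Main.v *)
(** An inner derivation D = [L_p, L_q] is skew, so its flow consists of
    isometric Jordan automorphisms, and w is orthogonal to D y for all such D
    exactly when y and w operator commute.  The orbit O of [a] under the
    isometric automorphisms is compact, and [a] minimizes Theta locally on O
    because F and E are invariant along O.

    For large K, let (x, y) minimize Theta x + K/2 |x - y|^2 + 1/2 |x - a|^2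
    over x near [a] and y in O; these minimizers tend to (a, a).  Optimality in
    x makes v = - K (x - y) - (x - a) a Frechet subgradient of Theta at x;
    optimality in y makes y operator commute with x - y, hence with
    v + (x - a).  If the v stay bounded, a limit of them is the required
    limiting subgradient.  Otherwise a limit of v / |v| is a unit horizon
    subgradient that operator commutes with [a], which the qualification
    condition excludes.

    Subsequences are replaced by limits along an ultrafilter; in particular the
    flow of D is the ultrafilter limit of the Euler iterates (1 + (t/n) D)^n. *)
From HB Require Import structures.
Require Import Defs.
From mathcomp Require Import all_boot all_order all_algebra.
From mathcomp Require Import all_classical all_reals all_analysis.
From mathcomp Require Import lra.
Set Implicit Arguments.
Unset Strict Implicit.
Unset Printing Implicit Defensive.
Import Order.TTheory GRing.Theory Num.Theory numFieldNormedType.Exports.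
Local Open Scope classical_set_scope.
Local Open Scope ring_scope.

(** * Inner product, linearized Jordan identity and inner derivations *)

Section EuclideanStructure.
Context {R : realType} {V : euclideanJordanType R}.
Implicit Types (x y z w u v p q : V) (c s t : R).

Definition ip x y : R := dot x y.
Local Notation "<[ x , y ]>" := (ip x y).
Local Notation "x ∘ y" := (jmul x y) (at level 40, left associativity).

Lemma ipC x y : <[x, y]> = <[y, x]>.
Proof. by rewrite /ip hermC /= expr0 mul1r. Qed.

Lemma ipDl x y z : <[x + y, z]> = <[x, z]> + <[y, z]>.
Proof. by rewrite /ip linearDl. Qed.

Lemma ipZl c x y : <[c *: x, y]> = c * <[x, y]>.
Proof. by rewrite /ip linearZl_LR. Qed.

Lemma ipNl x y : <[- x, y]> = - <[x, y]>.
Proof. by rewrite -scaleN1r ipZl mulN1r. Qed.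

Lemma ipDr x y z : <[x, y + z]> = <[x, y]> + <[x, z]>.
Proof. by rewrite ipC ipDl !(ipC x). Qed.

Lemma ipZr c x y : <[x, c *: y]> = c * <[x, y]>.
Proof. by rewrite ipC ipZl (ipC y). Qed.

Lemma ipNr x y : <[x, - y]> = - <[x, y]>.
Proof. by rewrite ipC ipNl (ipC y). Qed.

Definition ipE := (ipDl, ipDr, ipNl, ipNr, ipZl, ipZr).

Lemma ipxx x : <[x, x]> = `|x| ^+ 2.
Proof.
have ip0 : <[0, 0]> = 0 by rewrite -(scale0r 0) ipZl mul0r.
rewrite normr_dot; have [h|h] := leP 0 <[x, x]>; first by rewrite sqr_sqrtr.
(* [Num.sqrt] is 0 on negative reals, so a negative [<[x, x]>] would force [x = 0]. *)
have : `|x| = 0 by rewrite normr_dot ler0_sqrtr// ltW.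
by move/normr0_eq0 => x0; move: h; rewrite x0 ip0 ltxx.
Qed.

Lemma ip_inj x y : (forall p, <[x, p]> = <[y, p]>) -> x = y.
Proof.
move=> h; apply/eqP; rewrite -subr_eq0 -normr_eq0 -sqrf_eq0 -ipxx.
by rewrite ipDl ipNl h subrr.
Qed.

Lemma sqrnormD x y : `|x + y| ^+ 2 = `|x| ^+ 2 + 2 * <[x, y]> + `|y| ^+ 2.
Proof. by rewrite -!ipxx !ipE (ipC y x); lra. Qed.

Lemma jmulDl x y z : (x + y) ∘ z = x ∘ z + y ∘ z.
Proof. exact: linearDl. Qed.

Lemma jmulDr x y z : x ∘ (y + z) = x ∘ y + x ∘ z.
Proof. exact: linearDr. Qed.

Lemma jmulZl c x y : (c *: x) ∘ y = c *: (x ∘ y).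
Proof. exact: linearZl_LR. Qed.

Lemma jmulZr c x y : x ∘ (c *: y) = c *: (x ∘ y).
Proof. exact: linearZr. Qed.

Lemma jmulNl x y : (- x) ∘ y = - (x ∘ y).
Proof. by rewrite -scaleN1r jmulZl scaleN1r. Qed.

Lemma jmulNr x y : x ∘ (- y) = - (x ∘ y).
Proof. by rewrite -scaleN1r jmulZr scaleN1r. Qed.

Lemma ip_mul x y z : <[x ∘ y, z]> = <[y, x ∘ z]>.
Proof. exact: dot_jmul. Qed.

(* Inclusion-exclusion over the sums of x, y and z. *)
Lemma polarization3 (T : V -> V -> V -> R) x y z :
    (forall u v w p, T (u + v) w p = T u w p + T v w p) ->
    (forall u v w p, T w p (u + v) = T w p u + T w p v) ->
    (forall u v w, T u v w = T v u w) -> (forall u, T u u u = 0) ->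
  T x y z + T y z x + T z x y = 0.
Proof.
move=> D1 D3 C12 T0.
have D2 u v w p : T w (u + v) p = T w u p + T w v p.
  by rewrite C12 D1 !(C12 w).
move: (T0 (x + y + z)) (T0 (x + y)) (T0 (y + z)) (T0 (x + z)).
by rewrite !(D1, D2, D3) !T0 !(C12 y x) !(C12 x z) !(C12 z y) => *; lra.
Qed.

(** With [w] fixed, the defect [T] of the Jordan identity is trilinear, symmetric in its first two
    arguments and zero on the diagonal, so [polarization3] applies. *)
Lemma jordan_polarized x y z w :
  (x ∘ y) ∘ (z ∘ w) + (y ∘ z) ∘ (x ∘ w) + (z ∘ x) ∘ (y ∘ w) =
  z ∘ ((x ∘ y) ∘ w) + x ∘ ((y ∘ z) ∘ w) + y ∘ ((z ∘ x) ∘ w).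
Proof.
apply: ip_inj => p.
pose T u v r := <[(u ∘ v) ∘ (r ∘ w), p]> - <[r ∘ ((u ∘ v) ∘ w), p]>.
have : T x y z + T y z x + T z x y = 0.
  apply: polarization3 => [u v r q|u v r q|u v r|u]; rewrite /T.
  - by rewrite !(jmulDl, jmulDr) !ipDl opprD addrACA.
  - by rewrite !(jmulDl, jmulDr) !ipDl opprD addrACA.
  - by rewrite (jmulC u v).
  - by rewrite jordan_identity subrr.
rewrite /T !ipDl => h; apply/eqP; rewrite -subr_eq0 -h; apply/eqP; lra.
Qed.

Definition inner_der p q x := p ∘ (q ∘ x) - q ∘ (p ∘ x).

Lemma inner_derM p q x y :
  inner_der p q (x ∘ y) = inner_der p q x ∘ y + x ∘ inner_der p q y.
Proof.
have A := jordan_polarized p x y q; have B := jordan_polarized q x y p.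
(* [jordan_polarized] has a left-hand side symmetric in all four arguments. *)
have AB : y ∘ ((p ∘ x) ∘ q) + p ∘ ((x ∘ y) ∘ q) + x ∘ ((y ∘ p) ∘ q) =
          y ∘ ((q ∘ x) ∘ p) + q ∘ ((x ∘ y) ∘ p) + x ∘ ((y ∘ q) ∘ p).
  rewrite -A -B (jmulC (q ∘ x) (y ∘ p)) (jmulC q p) (jmulC (y ∘ q)).
  by rewrite (jmulC q x) (jmulC x p) [RHS]addrC [RHS]addrA [RHS]addrAC.
apply: ip_inj => r; move/(congr1 (ip^~ r)): AB; rewrite /inner_der.
rewrite !(jmulDl, jmulDr, jmulNl, jmulNr) !ipE.
rewrite (jmulC (p ∘ x) q) (jmulC (x ∘ y) q) (jmulC (y ∘ p) q) (jmulC y p).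
rewrite (jmulC (q ∘ x) p) (jmulC (x ∘ y) p) (jmulC (y ∘ q) p) (jmulC y q).
rewrite (jmulC (p ∘ (q ∘ x))) (jmulC (q ∘ (p ∘ x))) => ?; lra.
Qed.

(** [L_p] and [L_q] are self-adjoint, so their commutator is skew. *)
Lemma ip_inner_der p q x : <[x, inner_der p q x]> = 0.
Proof.
by rewrite /inner_der !ipE -(ip_mul p x) -(ip_mul q x) (ipC (q ∘ x)) subrr.
Qed.

Lemma operator_commuteP x y :
  operator_commute x y <-> forall z, x ∘ (y ∘ z) = y ∘ (x ∘ z).
Proof.
by split=> [h z|h]; [exact: (congr1 (@^~ z) h)|apply/funext => z; exact: h].
Qed.

Lemma operator_commuteZ y (c : R) (w : V) :
  operator_commute y w -> operator_commute y (c *: w).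
Proof.
move=> /operator_commuteP yw; apply/operator_commuteP => z.
by rewrite !jmulZl jmulZr yw.
Qed.

(** Self-adjointness turns [<w, [L_p, L_z] x>] into [<p, [L_w, L_x] z>], where [p] is arbitrary. *)
Lemma commute_inner_der x w :
    (forall p q, <[w, inner_der p q x]> = 0) ->
  forall z, x ∘ (w ∘ z) = w ∘ (x ∘ z).
Proof.
move=> h z; apply: ip_inj => p; move: (h p z).
rewrite /inner_der !ipE => /eqP; rewrite subr_eq0 => /eqP.
rewrite -(ip_mul p w) -(ip_mul z w) (jmulC p w) (jmulC z w).
rewrite (jmulC z x) (jmulC p x).
by rewrite ip_mul (ipC (w ∘ z)) ip_mul !(ipC p).
Qed.

End EuclideanStructure.

(** * Compact balls and boundedness of the product, through coordinates *)

Section FiniteDimension.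
Context {R : realType} {V : euclideanJordanType R}.
Implicit Types (x y z : V) (r : R).
Local Notation "x ∘ y" := (jmul x y) (at level 40, left associativity).
Local Notation n := (\dim {:V}).
Local Notation b := (vbasis {:V}).

(** Coordinate map that carries Heine-Borel from row vectors over to [V]. *)
Let vec (u : 'rV[R]_n) : V := \sum_i u 0 i *: b`_i.

Let vecZ (c : R) u : vec (c *: u) = c *: vec u.
Proof. by rewrite scaler_sumr; apply: eq_bigr => i _; rewrite mxE scalerA. Qed.

Let vec_coord x : vec (\row_i coord b i x) = x.
Proof.
by rewrite [RHS](coord_vbasis (memvf x)); apply: eq_bigr => i _; rewrite mxE.
Qed.

Let vec_eq0 u : vec u = 0 -> u = 0.
Proof.
move=> u0; apply/rowP => i; rewrite mxE.
have := coord_sum_free (fun j => u 0 j) i (basis_free (vbasisP {:V})).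
by rewrite -/(vec u) u0 linear0 => <-.
Qed.

Let vec_continuous : continuous vec.
Proof.
apply: continuous_big => [|i _ u]; first exact: add_continuous.
apply: (@cvgZr_tmp _ _ _ (nbhs u)); exact: coord_continuous.
Qed.

Let norm_vec_continuous : continuous (fun u => `|vec u|).
Proof.
move=> u.
exact: (continuous_comp (@vec_continuous u) (@norm_continuous _ _ _)).
Qed.

(** By injectivity [|vec u|] has a positive minimum on the compact unit sphere; homogeneity extends
    the bound to all [u]. *)
Let vec_lower_bound : exists2 m : R, 0 < m & forall u, m * `|u| <= `|vec u|.
Proof.
pose S := [set u : 'rV[R]_n | `|u| = 1].
suff [m m0 mS] : exists2 m : R, 0 < m & forall u, S u -> m <= `|vec u|.
  exists m => // u; have [->|u0] := eqVneq u 0.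
    by rewrite normr0 mulr0.
  have nu0 : 0 < `|u| by rewrite normr_gt0.
  have /mS : S (`|u|^-1 *: u).
    by rewrite /S/= normrZ gtr0_norm ?invr_gt0// mulVf ?gt_eqF.
  by rewrite vecZ normrZ gtr0_norm ?invr_gt0// mulrC ler_pdivlMr.
(* The sphere is empty when [V] has dimension 0; any [m] then works. *)
have [[u0 Su0]|/nonemptyPn S0] := pselect (S !=set0); last first.
  by exists 1 => // u; rewrite S0.
have cS : compact S.
  apply: bounded_closed_compact.
    exists 1; split; first exact: num_real.
    by move=> M M1 u /= ->; exact: ltW.
  rewrite /S -[X in closed X]/((fun u : 'rV[R]_n => `|u|) @^-1` [set 1]).
  apply: closed_comp; last exact: closed_eq.
  by move=> u _; exact: norm_continuous.
have [c Sc cmin] := compact_EVT_min (ex_intro _ u0 Su0) cS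
  (continuous_subspaceT norm_vec_continuous).
exists `|vec c|; last by move=> u Su; apply: cmin; rewrite inE.
rewrite normr_gt0; apply/eqP => /vec_eq0 c0.
by move: Sc; rewrite c0 inE /S/= normr0 => /eqP; rewrite eq_sym oner_eq0.
Qed.

Lemma compact_ball0 r : compact [set x : V | `|x| <= r].
Proof.
have [m m0 mP] := vec_lower_bound.
rewrite (_ : mkset _ = vec @` [set u | `|vec u| <= r]); last first.
  apply/seteqP; split => [x xr|_ [u ur <-]//].
  by exists (\row_i coord b i x); rewrite /= vec_coord.
apply: continuous_compact.
  by apply: continuous_subspaceT; exact: vec_continuous.
apply: bounded_closed_compact.
  exists (r / m); split; first exact: num_real.
  move=> M rM u/= ur; apply: le_trans (ltW rM).
  by rewrite ler_pdivlMr// mulrC (le_trans (mP u)).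
rewrite -[X in closed X]/((fun u => `|vec u|) @^-1` [set x | x <= r]).
apply: closed_comp; last exact: closed_le.
by move=> u _; exact: norm_vec_continuous.
Qed.

(** Both factors are expanded in the basis; each coordinate of [x] is at most [|x| / m]. *)
Lemma mul_bounded :
  exists2 B : R, 0 <= B & forall x y, `|x ∘ y| <= B * `|x| * `|y|.
Proof.
have [m m0 mP] := vec_lower_bound.
have coord_le i x : `|coord b i x| <= m^-1 * `|x|.
  rewrite mulrC ler_pdivlMr// mulrC -[X in _ <= `|X|](vec_coord x).
  apply: le_trans (mP _); rewrite ler_pM2l// [leRHS]/Num.norm /= mx_normrE.
  by apply/bigmax_geP; right; exists (0, i); rewrite //= mxE.
exists (\sum_(i < n) \sum_(j < n) m^-1 ^+ 2 * `|b`_i ∘ b`_j|).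
  by do 2!apply: sumr_ge0 => ? _; rewrite mulr_ge0// exprn_ge0// invr_ge0 ltW.
move=> x y; rewrite {1}(coord_vbasis (memvf y)) linear_sum.
rewrite (le_trans (ler_norm_sum _ _ _))// !mulr_suml.
apply: ler_sum => j _.
rewrite /= jmulZr jmulC {1}(coord_vbasis (memvf x)) linear_sum.
rewrite scaler_sumr (le_trans (ler_norm_sum _ _ _))// !mulr_suml.
apply: ler_sum => i _; rewrite /= jmulZr !normrZ.
have -> : m^-1 ^+ 2 * `|b`_j ∘ b`_i| * `|x| * `|y| =
    (m^-1 * `|y|) * ((m^-1 * `|x|) * `|b`_j ∘ b`_i|) by lra.
by rewrite !ler_pM ?mulr_ge0.
Qed.

Lemma cvg_mul T (G : set_system T) {FG : Filter G} (f g : T -> V) x y :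
  f @ G --> x -> g @ G --> y -> (fun k => f k ∘ g k) @ G --> x ∘ y.
Proof.
have [B B0 BP] := mul_bounded.
move=> fx gy.
have fx0 : `|f k - x| @[k --> G] --> (0 : R).
  by rewrite -(normr0 V) -(subrr x); exact: cvg_norm (cvgB fx (cvg_cst x)).
have gy0 : `|g k - y| @[k --> G] --> (0 : R).
  by rewrite -(normr0 V) -(subrr y); exact: cvg_norm (cvgB gy (cvg_cst y)).
apply/subr_cvg0/norm_cvg0P.
have lim0 : B * `|f k - x| * `|g k| + B * `|x| * `|g k - y|
    @[k --> G] --> (0 : R).
  have := cvgD (cvgM (cvgM (@cvg_cst R B _ _ _) fx0) (cvg_norm gy))
    (cvgM (@cvg_cst R (B * `|x|) _ _ _) gy0).
  by rewrite mulr0 mul0r mulr0 addr0; exact.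
apply: (@squeeze_cvgr _ G _ _ (fun=> 0) _ _ _ 0 (cvg_cst _) lim0).
near=> k; rewrite normr_ge0/=.
have -> : f k ∘ g k - x ∘ y = (f k - x) ∘ g k + x ∘ (g k - y).
  by rewrite jmulDl jmulDr jmulNl jmulNr addrA subrK.
by rewrite (le_trans (ler_normD _ _))// lerD.
Unshelve. all: by end_near. Qed.

Lemma inner_der_bounded p q :
  exists2 c : R, 0 <= c & forall x, `|inner_der p q x| <= c * `|x|.
Proof.
have [B B0 BP] := mul_bounded.
exists (2 * (B * `|p|) * (B * `|q|)); first by rewrite !mulr_ge0.
move=> x; rewrite (le_trans (ler_normB _ _))//.
have BB u v : `|u ∘ (v ∘ x)| <= (B * `|u|) * (B * `|v| * `|x|).
  by rewrite (le_trans (BP _ _))// ler_wpM2l// mulr_ge0.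
by rewrite (le_trans (lerD (BB _ _) (BB _ _)))//; lra.
Qed.
End FiniteDimension.

(** * Ultrafilter limits and compact orbits of isometric automorphisms *)

Lemma compact_ultra_cvg {T} {X : topologicalType} (U : set_system T)
    (A : set X) (f : T -> X) : UltraFilter U -> compact A ->
  (\forall k \near U, A (f k)) -> exists2 l, A l & f @ U --> l.
Proof.
move=> UU cA fA; have PU : ProperFilter U by exact: ultra_proper.
have [l [Al cl]] := cA (f @ U) _ fA.
(* Along an ultrafilter a cluster point is a limit: otherwise the complement of some neighbourhood
   [N] would be large and would have to meet [N]. *)
exists l => // N lN; have [//|UN] := in_ultra_setVsetC (f @^-1` N) UU.
by have [y [/= Ny ]] := cl (~` N) N UN lN.
Qed.

Section IsometricAutomorphisms.
Context {R : realType} {V : euclideanJordanType R}.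
Implicit Types (x y z : V) (r : R).
Local Notation "x ∘ y" := (jmul x y) (at level 40, left associativity).

Lemma ultra_bounded_cvg {T} (U : set_system T) (f : T -> V) r :
  UltraFilter U -> (\forall k \near U, `|f k| <= r) ->
  exists l : V, f @ U --> l.
Proof.
by move=> UU /(compact_ultra_cvg _ (@compact_ball0 _ _ r))[l _]; exists l.
Qed.

(** Norm preservation keeps orbits bounded and makes these maps injective, hence bijective in finite
    dimension. *)
Definition isom_aut : set 'End(V) :=
  [set X | (forall x, `|X x| = `|x|) /\ forall x y, X (x ∘ y) = X x ∘ X y].

Lemma isom_aut_jordan_aut X : isom_aut X -> jordan_aut X.
Proof.
move=> [Xn XM]; split=> //.
have Xinj : lker X == 0%VS.
  apply/lker0P => x y Xxy; apply/eqP; rewrite -subr_eq0 -normr_eq0 -Xn.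
  by rewrite linearB /= Xxy subrr normr0.
by exists (X^-1)%VF; [exact: lker0_lfunK|exact: lker0_lfunVK].
Qed.

Lemma isom_aut1 : isom_aut \1%VF.
Proof. by split=> [x|x y]; rewrite !lfunE. Qed.

Lemma isom_aut_comp X Y : isom_aut X -> isom_aut Y -> isom_aut (X \o Y)%VF.
Proof.
move=> [Xn XM] [Yn YM].
by split=> [x|x y]; rewrite !lfunE/= ?Xn ?Yn// YM XM.
Qed.

(** The maps [X_ k] need only be isometric and multiplicative in the limit, so that Euler iterates
    are covered as well as exact automorphisms. *)
Lemma isom_aut_ultra_limit {T} (U : set_system T) (X_ : T -> V -> V) :
    UltraFilter U ->
    (forall k, linear (X_ k)) ->
    (forall x, `|X_ k x| @[k --> U] --> `|x|) ->
    (forall x y, X_ k (x ∘ y) - X_ k x ∘ X_ k y @[k --> U] --> 0) ->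
  exists2 X, isom_aut X & forall x, X_ k x @[k --> U] --> X x.
Proof.
move=> UU Xlin Xn XM; have PU : ProperFilter U by exact: ultra_proper.
have /choice[f fP] x : exists l : V, X_ k x @[k --> U] --> l.
  apply: (@ultra_bounded_cvg _ _ _ (`|x| + 1)) => //.
  by apply: (cvgr_le _ (Xn x)); rewrite ltrDl.
have flin : linear f.
  move=> c x y; apply: (@cvg_unique _ _ (X_ k (c *: x + y) @[k --> U])) => //.
    exact: fP.
  rewrite (_ : (fun k => _) = (fun k => c *: X_ k x + X_ k y)); last first.
    by apply/funext => k; rewrite Xlin.
  have cfx : c *: X_ k x @[k --> U] --> c *: f x by apply: cvgZl_tmp; exact: fP.
  exact: cvgD cfx (fP y).
pose fL : {linear V -> V} := HB.pack f (GRing.isLinear.Build R V V *:%R f flin).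
have fE x : linfun fL x = f x by rewrite lfunE.
exists (linfun fL); last by move=> x; rewrite fE.
split=> [x|x y]; rewrite !fE.
- apply: (@cvg_unique _ _ (`|X_ k x| @[k --> U])) => //.
    exact: cvg_norm (fP x).
  exact: Xn.
- apply: (@cvg_unique _ _ (X_ k (x ∘ y) @[k --> U])) => //.
    exact: fP.
  exact: cvg_sub0 (XM x y) (cvg_mul (fP x) (fP y)).
Qed.

(** An ultrafilter on the orbit is lifted to automorphisms [X_ y] sending [a] to [y]; their limit
    [X] gives the limit point [X a]. *)
Lemma orbit_compact a : compact [set X a | X in isom_aut].
Proof.
rewrite compact_ultra => G UG Ga.
have PG : ProperFilter G by exact: ultra_proper.
(* The default value, the identity, keeps [X_ y] in [isom_aut] even off the orbit. *)
pose X_ (y : V) : 'End(V) := xget \1%VF [set X | isom_aut X /\ X a = y].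
have X_aut y : isom_aut (X_ y).
  by rewrite /X_; case: xgetP => [? -> []//|_]; exact: isom_aut1.
have [X Xaut XP] : exists2 X, isom_aut X & forall x, X_ y x @[y --> G] --> X x.
  apply: (@isom_aut_ultra_limit _ G (fun y => X_ y)) => [y|x|x y].
  - exact: linearP.
  - rewrite (_ : (fun y => _) = fun=> `|x|); first exact: cvg_cst.
    by apply/funext => z; rewrite (X_aut z).1.
  - rewrite (_ : (fun y => _) = fun=> 0); first exact: cvg_cst.
    by apply/funext => z; rewrite (X_aut z).2 subrr.
exists (X a); split; first by exists X.
apply: cvg_trans (XP a); apply: near_eq_cvg.
near=> y; have [Y Yaut Ya] : [set X a | X in isom_aut] y by near: y.
by rewrite /X_; case: xgetP => [? -> []//|/(_ Y)]; case.
Unshelve. all: by end_near. Qed.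
End IsometricAutomorphisms.

(** * Flow of an inner derivation by Euler iterates *)

Section Flow.
Context {R : realType} {V : euclideanJordanType R}.
Implicit Types (x y z : V) (r : R).
Local Notation "x ∘ y" := (jmul x y) (at level 40, left associativity).
Variables p q : V.
Local Notation D := (inner_der p q).

Let DD x y : D (x + y) = D x + D y.
Proof. by rewrite /inner_der !jmulDr opprD addrACA. Qed.

Let DZ (c : R) x : D (c *: x) = c *: D x.
Proof. by rewrite /inner_der !jmulZr -scalerBr. Qed.

Let DB x y : D (x - y) = D x - D y.
Proof. by rewrite -scaleN1r DD DZ scaleN1r. Qed.

Variables (B c : R).
Hypotheses (B0 : 0 <= B) (jmul_le : forall x y, `|x ∘ y| <= B * `|x| * `|y|).
Hypotheses (c0 : 0 <= c) (D_le : forall x, `|D x| <= c * `|x|).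

Definition euler_step (s : R) x := x + s *: D x.
Local Notation A := euler_step.

(** Bounds the growth of one Euler step. As [D] is skew there is no first-order term in [s], which
    is why [n] steps of length [t / n] become isometric in the limit. *)
Let g (s : R) := 1 + (s * c) ^+ 2.

Let g_ge1 s : 1 <= g s. Proof. by rewrite lerDl sqr_ge0. Qed.

Let gX_ge1 s j : 1 <= g s ^+ j. Proof. exact: exprn_ege1. Qed.

Let A_linear s j : linear (iter j (A s)).
Proof.
move=> a x y; elim: j => //= j ->.
rewrite /A DD DZ scalerDr scalerA mulrC -scalerA addrACA -scalerDr.
by [].
Qed.

Let step_ge s x : `|x| <= `|A s x|.
Proof.
rewrite -ler_sqr ?nnegrE// /A sqrnormD ipZr ip_inner_der mulr0 mulr0 addr0.
by rewrite lerDl sqr_ge0.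
Qed.

Let step_le s x : `|A s x| <= g s * `|x|.
Proof.
have g0 : 0 <= g s by rewrite (le_trans _ (g_ge1 s)).
rewrite -ler_sqr ?nnegrE ?mulr_ge0//.
rewrite sqrnormD ipZr ip_inner_der mulr0 mulr0 addr0.
rewrite normrZ exprMn real_normK ?num_real//.
have /(ler_wpM2l (sqr_ge0 s)) h : `|D x| ^+ 2 <= (c * `|x|) ^+ 2.
  by rewrite ler_sqr ?nnegrE ?mulr_ge0.
apply: le_trans (lerD (lexx _) h) _.
have -> : `|x| ^+ 2 + s ^+ 2 * (c * `|x|) ^+ 2 = g s * `|x| ^+ 2.
  by rewrite /g; lra.
(* The factor obtained for the norm is the square root of [g s], at most [g s] because
   [1 <= g s]. *)
by rewrite exprMn ler_wpM2r ?sqr_ge0// expr2 ler_peMr.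
Qed.

Let iter_ge s j x : `|x| <= `|iter j (A s) x|.
Proof. by elim: j => //= j /le_trans; apply; exact: step_ge. Qed.

Let iter_le s j x : `|iter j (A s) x| <= g s ^+ j * `|x|.
Proof.
elim: j => [|j IH]; first by rewrite expr0 mul1r.
rewrite iterS exprS -mulrA (le_trans (step_le _ _))// ler_wpM2l//.
exact: le_trans (g_ge1 s).
Qed.

(* By the Leibniz rule one Euler step maps x ∘ y to A x ∘ A y - s^2 (D x ∘ D y). *)
Let iter_mul s j x y :
  `|iter j (A s) (x ∘ y) - iter j (A s) x ∘ iter j (A s) y| <=
  j%:R * s ^+ 2 * (g s ^+ j) ^+ 2 * (B * c ^+ 2 * `|x| * `|y|).
Proof.
elim: j => [|j IH]; first by rewrite subrr normr0 !mul0r.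
set X := iter j (A s) x; set Y := iter j (A s) y.
set Z := iter j (A s) (x ∘ y).
have -> : iter j.+1 (A s) (x ∘ y) - iter j.+1 (A s) x ∘ iter j.+1 (A s) y =
    A s (Z - X ∘ Y) - s ^+ 2 *: (D X ∘ D Y).
  rewrite !iterS -/X -/Y -/Z /A DB inner_derM.
  apply: ip_inj => w.
  rewrite !(jmulDl, jmulDr, jmulZl, jmulZr, scalerDr, scalerBr) !ipE; lra.
have cX : `|D X| <= g s ^+ j * (c * `|x|).
  by rewrite mulrCA (le_trans (D_le _))// ler_wpM2l// iter_le.
have cY : `|D Y| <= g s ^+ j * (c * `|y|).
  by rewrite mulrCA (le_trans (D_le _))// ler_wpM2l// iter_le.
set K := (B * c ^+ 2 * `|x| * `|y|) in IH *.
have K0 : 0 <= K by rewrite !mulr_ge0// exprn_ge0.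
have G0 : 0 <= g s ^+ j by rewrite (le_trans _ (gX_ge1 s j)).
have bound : `|D X ∘ D Y| <= (g s ^+ j) ^+ 2 * K.
  rewrite (le_trans (jmul_le _ _))// -mulrA.
  have -> : (g s ^+ j) ^+ 2 * K =
      B * ((g s ^+ j * (c * `|x|)) * (g s ^+ j * (c * `|y|))).
    by rewrite /K; lra.
  by rewrite ler_wpM2l// ler_pM.
rewrite (le_trans (ler_normB _ _))// normrZ (ger0_norm (sqr_ge0 s)).
have G1 : 0 <= g s by rewrite (le_trans _ (g_ge1 s)).
have W0 : 0 <= s ^+ 2 * (g s ^+ j) ^+ 2 * K.
  by apply: mulr_ge0 => //; apply: mulr_ge0; exact: sqr_ge0.
(* Both error terms are given the factor [g s ^+ 2], which raises the power of [g s] from [j] to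
   [j.+1]. *)
have e1 : `|A s (Z - X ∘ Y)| <=
    (g s) ^+ 2 * (j%:R * (s ^+ 2 * (g s ^+ j) ^+ 2 * K)).
  rewrite (le_trans (step_le _ _))// expr2 -[leRHS]mulrA ler_wpM2l//.
  by rewrite (le_trans IH)// -!(mulrA j%:R) ler_peMl// mulr_ge0.
have e2 : s ^+ 2 * `|D X ∘ D Y| <=
    (g s) ^+ 2 * (s ^+ 2 * (g s ^+ j) ^+ 2 * K).
  apply: (@le_trans _ _ (s ^+ 2 * (g s ^+ j) ^+ 2 * K)).
    by rewrite -mulrA ler_wpM2l ?sqr_ge0.
  by rewrite ler_peMl// exprn_ege1.
apply: le_trans (lerD e1 e2) _.
by rewrite (exprS (g s) j) -natr1; lra.
Qed.

Let iter_sub s j y :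
  `|iter j (A s) y - y| <= j%:R * (`|s| * c) * g s ^+ j * `|y|.
Proof.
elim: j => [|j IH]; first by rewrite subrr normr0 !mul0r.
have -> : iter j.+1 (A s) y - y =
    (iter j (A s) y - y) + s *: D (iter j (A s) y).
  by rewrite iterS /A addrAC.
have e2 : `|s *: D (iter j (A s) y)| <= (`|s| * c) * (g s ^+ j * `|y|).
  by rewrite normrZ -mulrA ler_wpM2l// (le_trans (D_le _))// ler_wpM2l.
apply: le_trans (ler_normD _ _) _; apply: le_trans (lerD IH e2) _.
have -> : j%:R * (`|s| * c) * g s ^+ j * `|y| + `|s| * c * (g s ^+ j * `|y|) =
  j.+1%:R * (`|s| * c) * `|y| * g s ^+ j by rewrite -natr1; lra.
rewrite [leRHS]mulrAC ler_wpM2l ?mulr_ge0//.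
by rewrite exprS ler_peMl// (le_trans _ (gX_ge1 s j)).
Qed.

(** Each step adds [s *: D] of the deviation bounded in [iter_sub], hence an error of order
    [j * (s * c) ^+ 2]; the induction closes by [j ^ 2 + j <= (j + 1) ^ 2]. *)
Let iter_taylor s j y :
  `|iter j (A s) y - y - (j%:R * s) *: D y| <=
  (j%:R * s * c) ^+ 2 * g s ^+ j * `|y|.
Proof.
elim: j => [|j IH].
  by rewrite mul0r scale0r subrr subr0 normr0 !mul0r expr0n !mul0r.
have -> : iter j.+1 (A s) y - y - (j.+1%:R * s) *: D y =
   (iter j (A s) y - y - (j%:R * s) *: D y) + s *: D (iter j (A s) y - y).
  rewrite iterS /A DB -natr1 mulrDl mul1r scalerDl scalerBr.
  by apply: ip_inj => w; rewrite !ipE; lra.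
have e2 : `|s *: D (iter j (A s) y - y)| <=
    `|s| * c * (j%:R * (`|s| * c) * g s ^+ j * `|y|).
  rewrite normrZ -[leRHS]mulrA ler_wpM2l// (le_trans (D_le _))//.
  by rewrite ler_wpM2l// iter_sub.
apply: le_trans (ler_normD _ _) _; apply: le_trans (lerD IH e2) _.
have G0 : 0 <= g s ^+ j * `|y| by rewrite mulr_ge0// (le_trans _ (gX_ge1 s j)).
have s2 : `|s| * c * (j%:R * (`|s| * c) * g s ^+ j * `|y|) =
    j%:R * (s * c) ^+ 2 * (g s ^+ j * `|y|).
  by rewrite (exprMn 2 s c) -(real_normK (num_real s)); lra.
rewrite s2 -mulrA -mulrDl.
apply: (@le_trans _ _ ((j.+1%:R * s * c) ^+ 2 * (g s ^+ j * `|y|))).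
  rewrite ler_wpM2r// -natr1 -!(mulrA _ s) !(exprMn 2 _ (s * c)) -mulrDl.
  rewrite ler_wpM2r ?sqr_ge0//.
  by have := ler0n R j; nra.
rewrite -[leRHS]mulrA ler_wpM2l ?sqr_ge0// ler_wpM2r//.
by rewrite exprS ler_peMl// (le_trans _ (gX_ge1 s j)).
Qed.

Let G (t : R) (k : nat) := g (t / k.+1%:R) ^+ k.+1.

(** By [1 + x <= exp x], [G t k] lies between 1 and [exp ((t * c) ^ 2 / (k + 1))]. *)
Let G_cvg1 t : G t k @[k --> \oo] --> (1 : R).
Proof.
pose h k : R := expR ((t * c) ^+ 2 * harmonic k).
have h1 : h k @[k --> \oo] --> (1 : R).
  rewrite -expR0; apply: (continuous_cvg _ (@continuous_expR R 0)).
  rewrite -(mulr0 ((t * c) ^+ 2)).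
  by apply: cvgM; [exact: cvg_cst|exact: cvg_harmonic].
apply: (squeeze_cvgr _ (cvg_cst (1 : R)) h1).
near=> k; rewrite /G gX_ge1/=.
have -> : h k = expR ((t / k.+1%:R * c) ^+ 2) ^+ k.+1.
  rewrite /h /harmonic/= -expRM_natl; congr expR.
  have : k.+1%:R * k.+1%:R^-1 = 1 :> R by rewrite mulfV.
  set K := k.+1%:R; set K' := K^-1 => KK.
  have -> : K * (t * K' * c) ^+ 2 = (K * K') * ((t * c) ^+ 2 * K') by lra.
  by rewrite KK mul1r.
rewrite lerXn2r ?nnegrE ?expR_ge0 ?expR_ge1Dx//.
exact: le_trans (g_ge1 _).
Unshelve. all: by end_near. Qed.

(** With [k + 1] steps of length [t / (k + 1)], norms grow by a factor between 1 and [G t k], the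
    multiplicativity defect is of order [1 / (k + 1)], and [iter_taylor] applies with [j * s = t].
    All three bounds pass to the limit. *)
Lemma euler_flow t : exists2 X, isom_aut X &
  forall y, `|X y - y - t *: D y| <= c ^+ 2 * t ^+ 2 * `|y|.
Proof.
have [U [UU ooU]] := ultraFilterLemma (@eventually_filter).
have PU : ProperFilter U by exact: ultra_proper.
have cvgU (u : nat -> R) (l : R) : u @ \oo --> l -> u @ U --> l.
  by move=> ul N /ul; exact: ooU.
pose X_ k := iter k.+1 (A (t / k.+1%:R)).
have nK k : k.+1%:R * (t / k.+1%:R) = t by rewrite mulrCA mulfV// mulr1.
have GU : G t k @[k --> U] --> (1 : R) by apply: cvgU; exact: G_cvg1.
have [X Xaut XP] : exists2 X, isom_aut X & forall x, X_ k x @[k --> U] --> X x.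
  apply: (@isom_aut_ultra_limit _ _ _ U X_) => [k|x|x y].
  - exact: A_linear.
  - have Gx : G t k * `|x| @[k --> U] --> `|x|.
      have := cvgM GU (@cvg_cst R `|x| _ _ _); rewrite mul1r; exact.
    apply: (squeeze_cvgr _ (cvg_cst `|x|) Gx).
    by near=> k; rewrite iter_ge iter_le.
  - apply/norm_cvg0P.
    have lim0 : t ^+ 2 * (B * c ^+ 2 * `|x| * `|y|) *
        (harmonic k * G t k ^+ 2) @[k --> U] --> (0 : R).
      rewrite -[X in _ --> X](mulr0 (t ^+ 2 * (B * c ^+ 2 * `|x| * `|y|))).
      apply: cvgM; first exact: cvg_cst.
      rewrite -[X in _ --> X](mul0r (1 * 1)).
      by apply: cvgM; [apply: cvgU; exact: cvg_harmonic|exact: cvgM].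
    apply: (@squeeze_cvgr _ U _ _ (fun=> 0) _ _ _ 0 (cvg_cst _) lim0).
    near=> k; rewrite normr_ge0/= (le_trans (iter_mul _ _ _ _))//.
    rewrite /harmonic/= -/(G t k).
    have -> : k.+1%:R * (t / k.+1%:R) ^+ 2 = t ^+ 2 * k.+1%:R^-1.
      by rewrite expr2 mulrA nK mulrA.
    by set K := k.+1%:R^-1; set H := G t k; lra.
exists X => // y.
have lhs : `|X_ k y - y - t *: D y| @[k --> U] --> `|X y - y - t *: D y|.
  apply: cvg_norm; apply: cvgB; last exact: cvg_cst.
  by apply: cvgB; [exact: XP|exact: cvg_cst].
have rhs : (t * c) ^+ 2 * G t k * `|y| @[k --> U] --> (t * c) ^+ 2 * 1 * `|y|.
  apply: cvgM; last exact: cvg_cst.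
  by apply: cvgM; [exact: cvg_cst|exact: GU].
have -> : c ^+ 2 * t ^+ 2 * `|y| = (t * c) ^+ 2 * 1 * `|y| by lra.
apply: (ler_cvg_to lhs rhs).
by near=> k; have := iter_taylor (t / k.+1%:R) k.+1 y; rewrite nK.
Unshelve. all: by end_near. Qed.
End Flow.

Lemma inner_der_flow {R : realType} {V : euclideanJordanType R} (p q : V) :
  exists2 C : R, 0 <= C & forall t : R, exists2 X, isom_aut X &
    forall y, `|X y - y - t *: inner_der p q y| <= C * t ^+ 2 * `|y|.
Proof.
have [B B0 BP] := @mul_bounded R V; have [c c0 cP] := inner_der_bounded p q.
exists (c ^+ 2); first exact: sqr_ge0.
by move=> t; exact: (euler_flow B0 BP c0 cP t).
Qed.

(** * First variation of the distance along an orbit *)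

Section ClosestPoint.
Context {R : realType} {V : euclideanJordanType R}.
Implicit Types (x y z : V) (r : R).

Lemma ip_le x y : ip x y <= `|x| * `|y|.
Proof.
have : `|x + y| ^+ 2 <= (`|x| + `|y|) ^+ 2.
  by rewrite ler_sqr ?nnegrE ?addr_ge0// ler_normD.
by rewrite sqrnormD sqrrD -mulr_natl => ?; lra.
Qed.

(** Moving [y] for time [t] along an inner derivation [D] changes [|x - y| ^ 2] by
    [- 2 t <x - y, D y>] up to order [t ^ 2]. Minimality gives one sign, and exchanging [p] and [q]
    gives the other. *)
Lemma closest_isom_aut_commute x y :
    (forall X : 'End(V), isom_aut X -> `|x - y| <= `|x - X y|) ->
  operator_commute y (x - y).
Proof.
move=> xy; apply/operator_commuteP; apply: commute_inner_der => p q.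
set w := x - y in xy *.
suff le0 p' q' : ip w (inner_der p' q' y) <= 0.
  apply/eqP; rewrite eq_le le0/=; have := le0 q p.
  have -> : inner_der q p y = - inner_der p q y by rewrite /inner_der opprB.
  by rewrite ipNr oppr_le0.
have [C C0 flow] := inner_der_flow p' q'; set Dy := inner_der p' q' y.
set d := ip w Dy; rewrite leNgt; apply/negP => d0.
(* [M] collects the second-order terms: the first summand bounds [|u| ^ 2], the second comes from
   [ip w e]. *)
pose M := (`|Dy| + C * `|y|) ^+ 2 + 2 * `|w| * C * `|y|.
have M0 : 0 <= M by rewrite addr_ge0 ?sqr_ge0 ?mulr_ge0.
suff dM t : 0 < t -> t <= 1 -> d <= t * M.
  have dM1 : 0 < M + d + 1 by lra.
  (* The time [t = d / (M + d + 1)] lies in []0, 1]] and makes [t * M < d]. *)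
  have : d <= d / (M + d + 1) * M.
    by apply: dM; [rewrite divr_gt0|rewrite ler_pdivrMr//; lra].
  by rewrite mulrAC ler_pdivlMr//; nra.
move=> t0 t1; have [X Xaut /(_ y) XP] := flow t.
set e := X y - y - t *: _ in XP.
set u := t *: Dy + e.
have uE : X y - y = u by rewrite /u /e addrCA subrr addr0.
have wu : 2 * ip w u <= `|u| ^+ 2.
  have : `|w| ^+ 2 <= `|w - u| ^+ 2.
    by rewrite ler_sqr ?nnegrE// -uE /w opprB addrA subrK xy.
  by rewrite (sqrnormD w (- u)) ipNr normrN; lra.
have eb : ip w (- e) <= `|w| * (C * t ^+ 2 * `|y|).
  by rewrite (le_trans (ip_le _ _))// normrN ler_wpM2l.
have ub : `|u| <= t * (`|Dy| + C * `|y|).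
  rewrite (le_trans (ler_normD _ _))// normrZ gtr0_norm// mulrDr lerD2l.
  rewrite (le_trans XP)// (mulrC C) -mulrA ler_wpM2r ?mulr_ge0//.
  by rewrite expr2 ler_piMr// ltW.
have : `|u| ^+ 2 <= (t * (`|Dy| + C * `|y|)) ^+ 2.
  by rewrite ler_sqr ?nnegrE// (le_trans _ ub).
move: wu eb; rewrite ipNr /u ipDr ipZr -/d -/u => wu eb uu.
rewrite -(ler_pM2l t0); suff: 2 * (t * d) <= t * t * M * 2 by lra.
have : 0 <= t * t * M by rewrite mulr_ge0// ltW ?mulr_gt0.
rewrite /M; lra.
Qed.

End ClosestPoint.

(** * Lower semicontinuous minimization, Fréchet subgradients, and sequences drawn from filters *)

Lemma lsc_compact_min {R : realType} {X : topologicalType} (f : X -> \bar R)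
    (A : set X) : compact A -> A !=set0 ->
    (forall x, A x -> forall r : R, (r%:E < f x)%E ->
      \forall y \near x, (r%:E < f y)%E) ->
  exists2 c, A c & forall x, A x -> (f c <= f x)%E.
Proof.
move=> cA [a0 Aa0] lsc.
(* The sublevel sets are nested, hence a filter base on [A]; a cluster point of it is a
   minimizer. *)
pose B i := A `&` [set x | (f x <= f i)%E].
have FB : ProperFilter (filter_from A B).
  apply: filter_from_proper => [|i Ai]; last by exists i; split => /=.
  apply: filter_from_filter; first by exists a0.
  move=> i j Ai Aj; have [ij|/ltW ji] := leP (f i) (f j).
    by exists i => // x [Ax xi]; split; split=> //; exact: le_trans xi ij.
  by exists j => // x [Ax xj]; split; split=> //; exact: le_trans xj ji.
have [|c [Ac clc]] := cA _ FB; first by exists a0 => // x [].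
exists c => // x Ax; rewrite leNgt; apply/negP => xc.
(* Lower semicontinuity is tested at real levels only, so a real must separate the two extended
   values. *)
have [r xr rc] : exists2 r : R, (f x <= r%:E)%E & (r%:E < f c)%E.
  move: xc; case: (f x) (f c) => [s||] [s'||]//= xc; try by exists s.
  - by exists (s' - 1); rewrite ?leNye// lte_fin ltrBlDr ltrDl.
  - by exists 0; rewrite ?leNye ?ltry.
have [y [[_ /= yx] /= ry]] : B x `&` [set y | (r%:E < f y)%E] !=set0.
  by apply: clc; [exists x|exact: lsc].
by move: (le_lt_trans (le_trans yx xr) ry); rewrite ltxx.
Qed.

(** The difference quotients are at least [- C * |y - x|], so their lower limit is at least [- e]
    for every [e > 0]. *)
Lemma frechet_subdiff_minorant {R : realType} {V : euclideanJordanType R}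
    (f : V -> \bar R) (x v : V) (C : R) : f x \is a fin_num ->
    (\forall y \near x,
      (f x + (ip v (y - x) - C * `|y - x| ^+ 2)%:E <= f y)%E) ->
  frechet_subdiff f x v.
Proof.
move=> fx fy; split=> //; rewrite limf_einfE; apply/lee_subgt0Pr => e e0.
rewrite sub0e.
pose S := [set y | y != x /\
  (- e%:E <= (f y - f x - (dot v (y - x))%:E) / `|y - x|%:E)%E].
apply: (@le_trans _ _ (ereal_inf [set
   ((f y - f x - (dot v (y - x))%:E) / `|y - x|%:E)%E | y in S])).
  by apply: le_ereal_inf_tmp => _ [y [_ ?] <-].
apply: ereal_sup_ubound; exists S => //.
rewrite /dnbhs/within/=; near=> y => yx; split=> //.
have n0 : 0 < `|y - x| by rewrite normr_gt0 subr_eq0.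
rewrite inver gt_eqF// lee_pdivlMr//.
have : (f x + (ip v (y - x) - C * `|y - x| ^+ 2)%:E <= f y)%E by near: y.
move: fx; case: (f x) => //= s _; case: (f y) => [s'|_|]; first last.
- by rewrite -EFinD leeNy_eq.
- by rewrite !addye// leey.
rewrite -!EFinD -EFinM !lee_fin => h.
have Ce : C * `|y - x| <= e.
  (* The absolute value covers any sign of [C], and adding 1 avoids a zero denominator. *)
  have : ball x (e / (`|C| + 1)) y.
    by near: y; apply: nbhsx_ballx; rewrite divr_gt0// ltr_pwDr.
  rewrite -ball_normE/= distrC ltr_pdivlMr ?ltr_pwDr// => yxe.
  by rewrite mulrC (le_trans _ (ltW yxe))// ler_wpM2l// ler_wpDr// ler_norm.
have : C * `|y - x| ^+ 2 <= e * `|y - x| by rewrite expr2 mulrA ler_wpM2r.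
rewrite /ip in h *; lra.
Unshelve. all: by end_near. Qed.

Lemma harmonic_ball_cvg {R : realType} {Z : pseudoMetricType R}
    (z : nat -> Z) l :
  (forall n, ball l n.+1%:R^-1 (z n)) -> z @ \oo --> l.
Proof.
move=> zl; apply/cvg_ballP => e e0; near=> n.
apply: le_ball (zl n); apply: ltW; near: n.
exact: near_infty_natSinv_lt (PosNum e0).
Unshelve. all: by end_near. Qed.

(** Turns limits along an ultrafilter back into the sequences required by the subdifferentials: at
    stage [n], one index good to within [1 / (n + 1)] in every respect. *)
Lemma filter_diagonal {T} (U : set_system T) (P : nat -> set T) :
    ProperFilter U -> (forall n, U (P n)) ->
  exists k : nat -> T, forall n, P n (k n).
Proof.
move=> PU UP; have /choice[k kP] n : exists k, P n k by exact: filter_ex (UP n).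
by exists k.
Qed.

(** * Penalization and passage to the limit *)

Section Subdifferentials.
Context {R : realType} {V : euclideanJordanType R}.
Variables (f : V -> \bar R) (a : V).
Hypothesis fa : f a \is a fin_num.
Local Notation "x ∘ y" := (jmul x y) (at level 40, left associativity).

Lemma limiting_subdiff_filter {T} (U : set_system T) (x_ v_ : T -> V) v :
    ProperFilter U -> x_ @ U --> a -> f \o x_ @ U --> f a ->
    (\forall k \near U, frechet_subdiff f (x_ k) (v_ k)) -> v_ @ U --> v ->
  limiting_subdiff f a v.
Proof.
move=> PU xa fxa fv vv.
have [n|k kP] := @filter_diagonal _ U (fun n => [set k |
    [/\ ball a n.+1%:R^-1 (x_ k), ball (f a) n.+1%:R^-1 (f (x_ k)),
        frechet_subdiff f (x_ k) (v_ k) & ball v n.+1%:R^-1 (v_ k)]]) PU.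
  by near=> k; split; near: k => //; [apply: xa|apply: fxa|apply: vv];
    apply: nbhsx_ballx.
split=> //; exists (x_ \o k), (v_ \o k).
by split=> [||n|]; try (apply: harmonic_ball_cvg => n); case: (kP n).
Unshelve. all: by end_near. Qed.

Lemma horizon_subdiff_filter {T} (U : set_system T) (x_ v_ : T -> V)
    (t_ : T -> R) v :
    ProperFilter U -> x_ @ U --> a -> f \o x_ @ U --> f a ->
    (\forall k \near U, frechet_subdiff f (x_ k) (v_ k)) ->
    (\forall k \near U, 0 < t_ k) -> t_ @ U --> (0 : R) ->
    (fun k => t_ k *: v_ k) @ U --> v ->
  horizon_subdiff f a v.
Proof.
move=> PU xa fxa fv t0 tt0 vv.
have [n|k kP] := @filter_diagonal _ U (fun n => [set k |
    [/\ ball a n.+1%:R^-1 (x_ k), ball (f a) n.+1%:R^-1 (f (x_ k)),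
        frechet_subdiff f (x_ k) (v_ k),
        0 < t_ k /\ ball (0 : R) n.+1%:R^-1 (t_ k) &
        ball v n.+1%:R^-1 (t_ k *: v_ k)]]) PU.
  by near=> k; split; [| | |split|]; near: k => //;
    [apply: xa|apply: fxa|apply: tt0|apply: vv]; apply: nbhsx_ballx.
split=> //; exists (x_ \o k), (v_ \o k), (t_ \o k).
split=> [||n||]; last 2 first.
- split=> [n|]; first by case: (kP n) => _ _ _ [].
  by apply: harmonic_ball_cvg => n; case: (kP n) => _ _ _ [].
- by apply: harmonic_ball_cvg => n; case: (kP n).
- by apply: harmonic_ball_cvg => n; case: (kP n).
- by apply: harmonic_ball_cvg => n; case: (kP n).
- by case: (kP n).
Unshelve. all: by end_near. Qed.

Lemma operator_commute_limit {T} (U : set_system T) (y_ w_ : T -> V) w :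
    ProperFilter U -> y_ @ U --> a -> w_ @ U --> w ->
    (forall k, operator_commute (y_ k) (w_ k)) -> operator_commute a w.
Proof.
move=> PU ya ww yw; apply/operator_commuteP => z.
apply: (@cvg_unique _ _ (y_ k ∘ (w_ k ∘ z) @[k --> U])) => //.
  exact: cvg_mul ya (cvg_mul ww (cvg_cst z)).
rewrite (_ : (fun k => _) = (fun k => w_ k ∘ (y_ k ∘ z))).
  exact: cvg_mul ww (cvg_mul ya (cvg_cst z)).
by apply/funext => k; move/operator_commuteP: (yw k).
Qed.

Lemma compact_cball r : compact [set x : V | `|x - a| <= r].
Proof.
rewrite (_ : mkset _ = (fun x => x + a) @` [set x : V | `|x| <= r]).
  apply: continuous_compact; last exact: compact_ball0.
  apply: continuous_subspaceT => x.
  by apply: cvgD; [exact: cvg_id|exact: cvg_cst].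
apply/seteqP; split => [x xr|_ [x xr <-]]; last by rewrite /= addrK.
by exists (x - a); rewrite //= subrK.
Qed.

(** The first term pulls [x] towards the orbit point [y] as [K] grows; the second singles out [a]
    among minimizers on the orbit. *)
Let penalty (K : R) (x y : V) := K / 2 * `|x - y| ^+ 2 + 2^-1 * `|x - a| ^+ 2.

Let penalty_ge0 K x y : 0 <= K -> 0 <= penalty K x y.
Proof. by move=> K0; rewrite addr_ge0 ?mulr_ge0 ?sqr_ge0 ?divr_ge0. Qed.

Let penalty_continuous K : continuous (fun z : V * V => penalty K z.1 z.2).
Proof.
move=> z; rewrite /penalty.
have z1 : w.1 @[w --> z] --> z.1 by exact: cvg_fst.
have z2 : w.2 @[w --> z] --> z.2 by exact: cvg_snd.
have sq (g : V * V -> V) l : g @ z --> l ->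
    `|g w| ^+ 2 @[w --> z] --> `|l| ^+ 2.
  by move=> gl; rewrite expr2; apply: cvgM; exact: cvg_norm.
apply: cvgD; apply: cvgM; try exact: cvg_cst; apply: sq.
  exact: cvgB.
by apply: cvgB => //; exact: cvg_cst.
Qed.

(** The linear coefficient, negated, is the future subgradient; the quadratic term supplies the
    constant for [frechet_subdiff_minorant]. *)
Let penalty_expand K x y x' :
  penalty K x' y = penalty K x y +
    ip (K *: (x - y) + (x - a)) (x' - x) + (K + 1) / 2 * `|x' - x| ^+ 2.
Proof.
have e (c : V) : `|x' - c| ^+ 2 =
    `|x - c| ^+ 2 + 2 * ip (x - c) (x' - x) + `|x' - x| ^+ 2.
  by rewrite -sqrnormD [X in _ = `|X| ^+ 2]addrC addrA subrK.
by rewrite /penalty (e y) (e a) (ipDl (K *: _)) ipZl; lra.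
Qed.

Let orbit : set V := [set X a | X in @isom_aut R V].

Lemma penalized_minimizer (K d : R) : 0 <= d ->
    (forall x, `|x - a| <= d -> lower_semicontinuous_at f x) ->
  exists z : V * V, [/\ `|z.1 - a| <= d, orbit z.2 &
    forall x y, `|x - a| <= d -> orbit y ->
      (f z.1 + (penalty K z.1 z.2)%:E <= f x + (penalty K x y)%:E)%E].
Proof.
move=> d0 lsc.
have orba : orbit a by exists \1%VF; [exact: isom_aut1|rewrite lfunE].
pose A := [set x : V | `|x - a| <= d] `*` orbit.
have [||z [zx yz]|z [zd zo] zmin] := @lsc_compact_min R _
  (fun z : V * V => (f z.1 + (penalty K z.1 z.2)%:E)%E) A.
- apply: compact_setX; [exact: compact_cball|exact: orbit_compact].
- by exists (a, a); split => //=; rewrite subrr normr0.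
- move=> r rz.
  (* The level [r] is split as [s + (r - s)], each part lying strictly below its own summand. *)
  have [s rs sf] : exists2 s : R, r - penalty K z.1 z.2 < s & (s%:E < f z.1)%E.
    move: rz; case: (f z.1) => [u||]//=.
    - rewrite -EFinD lte_fin => ru; exists ((u + (r - penalty K z.1 z.2)) / 2).
        by lra.
      by rewrite lte_fin; lra.
    - by move=> _; exists (r - penalty K z.1 z.2 + 1); rewrite ?ltry ?ltrDl.
  have fs : \forall w \near z, (s%:E < f w.1)%E.
    have z1 : w.1 @[w --> z] --> z.1 by exact: cvg_fst.
    exact: z1 (lsc _ zx s sf).
  have ps : \forall w \near z, r - s < penalty K w.1 w.2.
    by apply: (cvgr_gt _ (@penalty_continuous K z)); lra.
  near=> w.
  have := @lteD R s%:E (f w.1) (r - s)%:E (penalty K w.1 w.2)%:E.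
  rewrite -EFinD addrCA subrr addr0; apply; last rewrite lte_fin; by near: w.
- by exists z; split=> // x y xd oy; exact: (zmin (x, y)).
Unshelve. all: by end_near. Qed.


Lemma ultra_penalization :
    (\forall x \near a, lower_semicontinuous_at f x) ->
    (\forall x \near a, orbit x -> (f a <= f x)%E) ->
  exists (U : set_system nat) (x_ y_ v_ : nat -> V),
    [/\ UltraFilter U, x_ @ U --> a, y_ @ U --> a, f \o x_ @ U --> f a &
      (\forall k \near U, frechet_subdiff f (x_ k) (v_ k)) /\
      forall k, operator_commute (y_ k) (v_ k + (x_ k - a))].
Proof.
move=> lsc amin.
pose m := fine (f a); have fm : f a = m%:E by rewrite /m fineK.
have lower (e : R) : 0 < e -> \forall x \near a, ((m - e)%:E < f x)%E.
  by move=> e0; apply: (nbhs_singleton lsc); rewrite fm lte_fin ltrBlDr ltrDl.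
(* The lower bound [m - 1] rules out the value [-oo] and keeps the penalties at the minimizers below
   1. *)
have [d d0 dP] : exists2 d : R, 0 < d & forall x, `|x - a| <= d ->
    [/\ lower_semicontinuous_at f x, orbit x -> (f a <= f x)%E &
        ((m - 1)%:E < f x)%E].
  have : \forall x \near a, [/\ lower_semicontinuous_at f x,
      orbit x -> (f a <= f x)%E & ((m - 1)%:E < f x)%E].
    by near=> x; split; near: x => //; exact: lower.
  move=> /nbhs_ballP[e/= e0 eP]; exists (e / 2); first by rewrite divr_gt0.
  move=> x xa; apply: eP; rewrite -ball_normE/= distrC (le_lt_trans xa)//.
  by rewrite ltr_pdivrMr// ltr_pMr// ltr1n.
have oa : orbit a by exists \1%VF; [exact: isom_aut1|rewrite lfunE].
have /choice[z zP] (k : nat) := @penalized_minimizer k.+1%:R d (ltW d0)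
  (fun x xd => let: And3 h _ _ := dP x xd in h).
pose x_ k := (z k).1; pose y_ k := (z k).2.
pose v_ k := - (k.+1%:R *: (x_ k - y_ k) + (x_ k - a)).
have aa : `|a - a| <= d by rewrite subrr normr0 ltW.
(* Comparison with the pair [(a, a)], whose penalty is 0. *)
have fxk k : exists2 r : R, f (x_ k) = r%:E &
    m - 1 < r /\ r + penalty k.+1%:R (x_ k) (y_ k) <= m.
  have [xd yo /(_ a a aa oa)] := zP k; have [_ _] := dP _ xd.
  rewrite fm -/(x_ k) -/(y_ k) /penalty !subrr !normr0 expr0n !mulr0 addr0.
  case: (f (x_ k)) => [r||]//=; rewrite -!EFinD ?lee_fin ?lte_fin addr0 => ? ?.
  by exists r.
have xy_small k : `|x_ k - y_ k| ^+ 2 <= 2 * harmonic k.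
  have [r _ [r1 rp]] := fxk k; move: rp; rewrite /penalty /harmonic/=.
  have := sqr_ge0 `|x_ k - a|.
  set n : R := k.+1%:R => xa0 rp; have n0 : 0 < n by rewrite ltr0n.
  by rewrite ler_pdivlMr//; lra.
have [U [UU ooU]] := ultraFilterLemma (@eventually_filter).
have PU : ProperFilter U by exact: ultra_proper.
have xy0 : x_ k - y_ k @[k --> U] --> 0.
  apply/norm_cvg0P.
  have : Num.sqrt (`|x_ k - y_ k| ^+ 2) @[k --> U] --> Num.sqrt 0.
    apply: (continuous_cvg _ (@sqrt_continuous R 0)).
    have h0 : 2 * harmonic k @[k --> U] --> (0 : R).
      have := cvgM (@cvg_cst R 2 _ _ _) (@cvg_harmonic R); rewrite mulr0 => h.
      by move=> N /h; exact: ooU.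
    apply: (@squeeze_cvgr _ U _ _ (fun=> 0) _ _ _ 0 (cvg_cst _) h0).
    by near=> k; rewrite sqr_ge0 xy_small.
  rewrite sqrtr0; under eq_fun do rewrite sqrtr_sqr normr_id.
  exact.
have [x0 x0d xx0] : exists2 x0, [set x : V | `|x - a| <= d] x0 & x_ @ U --> x0.
  apply: compact_ultra_cvg; first exact: compact_cball.
  by near=> k; have [] := zP k.
have [y0 y0o yy0] : exists2 y0, orbit y0 & y_ @ U --> y0.
  apply: compact_ultra_cvg; first exact: orbit_compact.
  by near=> k; have [] := zP k.
have x0y0 : x0 = y0.
  apply: (@cvg_unique _ _ (x_ @ U)) => //.
  by apply: cvg_sub0 xy0 yy0.
have [lsc0 min0 _] := dP _ x0d.
(* The limit [x0 = y0] is on the orbit, so [f a <= f x0]. Lower semicontinuity then gives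
   [f (x_ k) > m - e / 2], leaving less than [e / 2] for the term [|x_ k - a| ^ 2 / 2]. *)
have x0a : x0 = a.
  apply/eqP; rewrite -subr_eq0 -normr_eq0 -sqrf_eq0 eq_le sqr_ge0 andbT.
  apply/ler_addgt0Pr => e e0; rewrite add0r.
  have fx0 : \forall k \near U, ((m - e / 2)%:E < f (x_ k))%E.
    have h : ((m - e / 2)%:E < f x0)%E.
      apply: (@lt_le_trans _ _ (f a)); last by apply: min0; rewrite x0y0.
      by rewrite fm lte_fin; lra.
    exact: (xx0 _ (lsc0 _ h)).
  have lim : `|x_ k - a| ^+ 2 @[k --> U] --> `|x0 - a| ^+ 2.
    have n0 : `|x_ k - a| @[k --> U] --> `|x0 - a|.
      by apply: cvg_norm; apply: cvgB => //; exact: cvg_cst.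
    by rewrite expr2; exact: cvgM.
  apply: (cvgr_to_le lim); near=> k.
  have [r fr [_]] := fxk k.
  have : ((m - e / 2)%:E < f (x_ k))%E by near: k.
  rewrite fr lte_fin /penalty.
  have : 0 <= k.+1%:R / 2 * `|x_ k - y_ k| ^+ 2 by rewrite mulr_ge0 ?sqr_ge0.
  lra.
exists U, x_, y_, v_; split => //.
- by rewrite -x0a.
- by rewrite -x0a x0y0.
(* Lower semicontinuity bounds [f (x_ k)] from below, the comparison [fxk] from above. *)
- rewrite fm; apply/fine_cvgP; split.
    by near=> k; have [r /= -> _] := fxk k.
  apply/cvgrPdist_le => e e0.
  have low : \forall x \near x0, ((m - e)%:E < f x)%E.
    by rewrite x0a; exact: lower.
  near=> k; have : ((m - e)%:E < f (x_ k))%E by near: k; exact: (xx0 _ low).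
  have [r fr [_ rm]] := fxk k; have := penalty_ge0 (x_ k) (y_ k) (ler0n R k.+1).
  by rewrite /= fr/= lte_fin ler_distlC => *; lra.
split.
(* Once [x_ k] is interior to the ball, its minimality holds against all nearby [x]. *)
- have xk_int : \forall k \near U, `|x_ k - a| < d.
    have : `|x_ k - a| @[k --> U] --> (0 : R).
      rewrite -(normr0 V) -(subrr a); apply: cvg_norm.
      apply: cvgB; last exact: cvg_cst.
      by rewrite -[X in _ --> X]x0a.
    by move=> /(cvgr_lt _); apply.
  near=> k; have xk_d : `|x_ k - a| < d by near: k.
  have [r fr _] := fxk k; have [_ yo kmin] := zP k.
  apply: (@frechet_subdiff_minorant _ _ _ _ _ ((k.+1%:R + 1) / 2)).
    by rewrite fr.
  near=> x; have xd : `|x - a| <= d.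
    near: x.
    have : `|x - a| @[x --> x_ k] --> `|x_ k - a|.
      by apply: cvg_norm; apply: cvgB; [exact: cvg_id|exact: cvg_cst].
    by move=> /(cvgr_le _); apply.
  pose I := ip (k.+1%:R *: (x_ k - y_ k) + (x_ k - a)) (x - x_ k).
  have -> : ip (v_ k) (x - x_ k) = - I by exact: ipNl.
  have := penalty_expand k.+1%:R (x_ k) (y_ k) x; rewrite -/I.
  pose N := `|x - x_ k| ^+ 2; rewrite -/N => pE.
  have := kmin x (y_ k) xd yo; rewrite -/(x_ k) -/(y_ k) fr pE.
  case: (f x) => [s|_|]; last by rewrite -EFinD addNye leeNy_eq.
    by rewrite -!EFinD !lee_fin => h; lra.
  by rewrite leey.
(* With [x_ k] fixed only [|x_ k - y| ^ 2] varies, so [y_ k] is a closest orbit point to [x_ k]. *)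
- move=> k; have -> : v_ k + (x_ k - a) = - k.+1%:R *: (x_ k - y_ k).
    by rewrite /v_ opprD subrK scaleNr.
  apply: operator_commuteZ; apply: closest_isom_aut_commute => X Xaut.
  have [xd [Y Yaut Ya] /(_ (x_ k) (X (y_ k)) xd)] := zP k.
  have oX : orbit (X (y_ k)).
    exists (X \o Y)%VF; first exact: isom_aut_comp.
    by rewrite lfunE/= Ya.
  move=> /(_ oX); have [r fr _] := fxk k; rewrite -/(x_ k) -/(y_ k) fr.
  rewrite -!EFinD lee_fin /penalty => h.
  rewrite -ler_sqr ?nnegrE// -(ler_pM2l (_ : 0 < k.+1%:R / 2 :> R)) ?divr_gt0//.
  lra.
Unshelve. all: by end_near. Qed.

End Subdifferentials.

(** * Bounded and unbounded subgradients along the ultrafilter *)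

Theorem theorem4 (R : realType) (V : euclideanJordanType R)
  (Theta : V -> \bar R) (F : V -> R) (E : set V) (a : V)
  (hF : weakly_spectral_fun F) (hE : weakly_spectral_set E)
  (hreg : subdiff_regular Theta a)
  (hmin : local_minimizer E (fun x => (Theta x + (F x)%:E)%E) a)
  (hqual : forall v : V,
     horizon_subdiff Theta a v -> operator_commute a v -> v = 0) :
  exists v : V, limiting_subdiff Theta a v /\ operator_commute a v.
Proof.
have [fa lsc _ _ _] := hreg; have [Ea amin] := hmin.
have [|U [x_ [y_ [v_ [UU xa ya fxa [fv yv]]]]]] := ultra_penalization fa lsc.
  near=> x => -[X Xaut Xa]; have Xjaut := isom_aut_jordan_aut Xaut.
  have : (Theta a + (F a)%:E <= Theta x + (F x)%:E)%E.
    have : E x -> (Theta a + (F a)%:E <= Theta x + (F x)%:E)%E by near: x.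
    by apply; rewrite -Xa; exact: hE.
  by rewrite -Xa hF// leeD2rE.
have PU : ProperFilter U by exact: ultra_proper.
have xa0 : x_ k - a @[k --> U] --> 0.
  by rewrite -(subrr a); apply: cvgB => //; exact: cvg_cst.
have [[M vM]|unbounded] :=
  pselect (exists M : R, \forall k \near U, `|v_ k| <= M).
  have [v vv] := ultra_bounded_cvg UU vM.
  exists v; split; first exact: (limiting_subdiff_filter fa PU xa fxa fv vv).
  apply: (operator_commute_limit PU ya _ yv).
  by have := cvgD vv xa0; rewrite addr0; exact.
(* For an ultrafilter, failing to be bounded by [M] on a large set means exceeding [M] on one; hence
   [|v_ k|] tends to infinity. *)
have vgt (M : R) : \forall k \near U, M < `|v_ k|.
  have [vM|] := in_ultra_setVsetC [set k | `|v_ k| <= M] UU.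
    by exfalso; apply: unbounded; exists M.
  by apply: filterS => k /= /negP; rewrite -ltNge.
pose t_ k := `|v_ k|^-1.
have t_gt0 : \forall k \near U, 0 < t_ k.
  by apply: filterS (vgt 0) => k vk; rewrite invr_gt0.
have t0 : t_ @ U --> (0 : R).
  apply/cvgrPdist_le => e e0; near=> k.
  rewrite sub0r normrN ger0_norm /t_ ?invr_ge0// invf_ple ?posrE//.
    by apply: ltW; near: k.
  by near: k.
have tv1 : \forall k \near U, `|t_ k *: v_ k| = 1.
  near=> k; have vk0 : 0 < `|v_ k| by near: k.
  by rewrite normrZ /t_ normfV normr_id mulVf// gt_eqF.
have [|u uu] := @ultra_bounded_cvg _ _ _ U (fun k => t_ k *: v_ k) 1 UU.
  by apply: filterS tv1 => k ->.
have u0 : u = 0.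
  apply: hqual.
    exact: (horizon_subdiff_filter fa PU xa fxa fv t_gt0 t0 uu).
  (* The rescaled vectors [t_ k *: (v_ k + (x_ k - a))] also tend to [u], since [t_ k] and
     [x_ k - a] tend to 0. *)
  apply: (operator_commute_limit PU ya _
    (fun k => operator_commuteZ (t_ k) (yv k))).
  rewrite (_ : (fun k => _) = (fun k => t_ k *: v_ k + t_ k *: (x_ k - a))).
    by have := cvgD uu (cvgZ t0 xa0); rewrite scaler0 addr0; exact.
  by apply/funext => k; exact: scalerDr.
have : `|u| = 1.
  apply: (@cvg_unique _ _ (`|t_ k *: v_ k| @[k --> U])) => //.
    exact: cvg_norm.
  exact: cvg_near_cst tv1.
by rewrite u0 normr0 => /eqP; rewrite eq_sym oner_eq0.
Unshelve. all: by end_near. Qed.
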